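(* Let $R$ be a unitary ring with involution $*$ and let $a\in R$. Then $a$ is weak group invertible if and only if $a$ is Drazin invertible and there exists an idempotent $f\in R$ such that $fR=aa^{D}R$ and $(a^{D})^{*}af=(a^{D})^{*}a$. In this case, $a^{D}f$ is one of the weak group inverses of $a$.
   Context: $R$ is an associative ring with identity $1$ equipped with an involution, i.e. a map $a\mapsto a^{*}$ with $(a+b)^{*}=a^{*}+b^{*}$, $(ab)^{*}=b^{*}a^{*}$, $(a^{*})^{*}=a$ for all $a,b\in R$. $\mathbb{N}^{+}$ is the set of positive integers. For $a\in R$, $aR=\{ax: x\in R\}$. Drazin inverse: $a\in R$ is Drazin invertible if there exist $x\in R$ and $k\in\mathbb{N}^{+}$ with $xa^{k+1}=a^{k}$, $xax=x$, $xa=ax$; such $x$ is unique and denoted $a^{D}$. Weak group inverse: for $a\in R$, an element $x\in R$ is called a weak group inverse of $a$ if there exists $k\in\mathbb{N}^{+}$ such that $xa^{k+1}=a^{k}$, $ax^{2}=x$, and $(a^{k})^{*}a^{2}x=(a^{k})^{*}a$. It need not be unique; $a$ is weak group invertible if it has at least one weak group inverse. *)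

(* Defs.v *)
From HB Require Import structures.
From mathcomp Require Import all_boot all_order all_algebra.
From mathcomp Require Import boolp classical_sets.

Set Implicit Arguments.
Unset Strict Implicit.
Unset Printing Implicit Defensive.
Import GRing.Theory.
Local Open Scope ring_scope.

HB.mixin Record hasInvolution R of GRing.PzRing R := {
  star : R -> R;
  starD : {morph star : a b / a + b >-> a + b};
  starM : {morph star : a b / a * b >-> b * a};
  starK : involutive star
}.

#[short(type="starRingType")]
HB.structure Definition StarRing := { R of GRing.PzRing R & hasInvolution R }.

Section Inverses.
Variable R : pzRingType.
Implicit Types a x : R.

Definition principal_right_ideal a : set R := [set a * x | x in [set: R]]%classic.

Definition is_drazin_inverse a x : Prop :=
  exists2 k : nat, (0 < k)%N &
    [/\ x * a ^+ k.+1 = a ^+ k, x * a * x = x & x * a = a * x].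

Definition drazin_invertible a : Prop := exists x, is_drazin_inverse a x.

(* By drazin_inverse_uniq below, this is the Drazin inverse of [a] when [a] is
   Drazin invertible; otherwise it is the junk value 0. *)
Definition drazin_inverse a : R := xget 0 (is_drazin_inverse a).

Lemma drazin_inverseP a :
  drazin_invertible a -> is_drazin_inverse a (drazin_inverse a).
Proof. by case=> x hx; exact: xgetI hx. Qed.

Lemma drazin_inverse_uniq a x y :
  is_drazin_inverse a x -> is_drazin_inverse a y -> x = y.
Proof.
move=> [k _ [xk xax xa]] [l _ [yl yay ya]].
have xE n : x = a ^+ n * x ^+ n.+1.
  elim: n => [|n IHn]; first by rewrite mul1r.
  by rewrite exprS exprSr mulrA -(mulrA a) -IHn -xa xax.
have yE n : y = y ^+ n.+1 * a ^+ n.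
  elim: n => [|n IHn]; first by rewrite mulr1.
  by rewrite (exprS y) (exprSr a) mulrA -(mulrA y) -IHn -mulrA ya mulrA yay.
have ax : a ^+ k.+1 * x = a ^+ k by rewrite -(commrX k.+1 xa) xk.
transitivity (y * a * x).
  by rewrite [in RHS](xE l) mulrA -(mulrA y) -exprS yl -xE.
by rewrite [in LHS](yE k) -(mulrA _ _ a) -exprSr -mulrA ax -yE.
Qed.

End Inverses.

Section WeakGroupInverse.
Variable R : starRingType.
Implicit Types a x : R.

Definition is_weak_group_inverse a x : Prop :=
  exists2 k : nat, (0 < k)%N &
    [/\ x * a ^+ k.+1 = a ^+ k,
        a * x ^+ 2 = x &
        star (a ^+ k) * a ^+ 2 * x = star (a ^+ k) * a].

Definition weak_group_invertible a : Prop :=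
  exists x, is_weak_group_inverse a x.

End WeakGroupInverse.

(* Main.v *)
Require Import Defs.
From mathcomp Require Import all_boot all_order all_algebra.
From mathcomp Require Import boolp classical_sets.

Set Implicit Arguments.
Unset Strict Implicit.
Unset Printing Implicit Defensive.
Import GRing.Theory.
Local Open Scope ring_scope.

(** Write [d] for the Drazin inverse of [a].  Two idempotents generate the same
    right ideal exactly when each is a left identity for the other
    ([principal_right_ideal_idemP]), so the condition on the idempotent [f]
    amounts to [f * (a * d) = a * d] and [a * d * f = f].

    If [x] is a weak group inverse of [a] with exponent [k], the relations
    [x * a ^+ k.+1 = a ^+ k] and [a * x ^+ 2 = x] alone force [a] to be Drazin
    invertible, with Drazin inverse [x ^+ k.+1 * a ^+ k]
    ([drazin_of_left_inverse]).  They also make [a * x] idempotent, and this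
    is the required [f]: both [a * x] and [a * d] are right multiples of
    [a ^+ k], which either idempotent fixes under left multiplication.

    Conversely, [f] fixes every element of the right ideal of [a * d], hence
    [d] and [a ^+ k.+1], while [a * d] fixes [f]; this gives the two relations
    without the involution for [d * f].

    The conditions with the involution correspond to each other because [d]
    and [a ^+ k] are right multiples of each other, namely
    [d = a ^+ k * d ^+ k.+1] and [a ^+ k = d * a ^+ k.+1], so that an equation
    multiplied on the left by the star of one can be multiplied on the left by
    the star of the other ([star_cancel_right_multiple]). *)

Section Ring.
Variable R : pzRingType.
Implicit Types a d e f x : R.

Lemma principal_right_ideal_idemP e f : e * e = e -> f * f = f ->
  principal_right_ideal f = principal_right_ideal e <->
  f * e = e /\ e * f = f.
Proof.
have fix_left g h : g * g = g ->
    principal_right_ideal g = principal_right_ideal h -> g * h = h.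
  move=> gg gh; have : principal_right_ideal h h by exists 1; rewrite ?mulr1.
  by rewrite -gh => -[u _ <-]; rewrite mulrA gg.
move=> ee ff; split=> [fe | [fe ef]].
  by split; exact: fix_left.
by apply/seteqP; split=> _ [u _ <-]; [exists (f * u) | exists (e * u)] => //;
  rewrite mulrA ?ef ?fe.
Qed.

Section OuterPowers.
Variables a x : R.
Hypothesis axx : a * x ^+ 2 = x.

Lemma mul_outer_exprS n : a * x ^+ n.+2 = x ^+ n.+1.
Proof. by rewrite -addn2 addnC exprD mulrA axx -exprS. Qed.

Lemma expr_outer n : a ^+ n * x ^+ n.+1 = x.
Proof.
by elim: n => [|n IHn]; rewrite ?mul1r // exprSr -mulrA mul_outer_exprS.
Qed.

Variable k : nat.
Hypothesis xak : x * a ^+ k.+1 = a ^+ k.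

Lemma expr_left_cancel n : x ^+ n * a ^+ (n + k) = a ^+ k.
Proof.
elim: n => [|n IHn]; first by rewrite mul1r.
have xa_nk : x * a ^+ (n + k).+1 = a ^+ (n + k).
  by rewrite addnC -addSn exprD mulrA xak -exprD.
by rewrite addSn exprSr -mulrA xa_nk.
Qed.

Lemma outer_inverse : x * a * x = x.
Proof.
(* Writing the last [x] as [a ^+ k * x ^+ k.+1] produces the power [a ^+ k.+1]
   against which the first [x] cancels. *)
by rewrite -{2}(expr_outer k) mulrA -(mulrA x a) -exprS xak expr_outer.
Qed.

(** The element [x ^+ k.+1 * a ^+ k] commutes with [a] because both products
    collapse to [x ^+ k * a ^+ k]; multiplying by [a] on the left removes
    one factor [x] from [x ^+ k.+1], which requires [k] to be positive. *)
Lemma drazin_of_left_inverse :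
  (0 < k)%N -> is_drazin_inverse a (x ^+ k.+1 * a ^+ k).
Proof.
move=> k_gt0.
have axk : a * x ^+ k.+1 = x ^+ k.
  by case: k k_gt0 => // n _; exact: mul_outer_exprS.
have da : x ^+ k.+1 * a ^+ k * a = x ^+ k * a ^+ k.
  by rewrite -mulrA -exprSr exprSr -mulrA xak.
exists k => //; split.
- by rewrite -mulrA -exprD addnC expr_left_cancel.
- by rewrite da -mulrA (mulrA (a ^+ k)) expr_outer mulrA -exprSr.
- by rewrite da mulrA axk.
Qed.

End OuterPowers.

Section DrazinPowers.
Variables (a d : R) (k : nat).
Hypotheses (dak : d * a ^+ k.+1 = a ^+ k) (dad : d * a * d = d).
Hypothesis da : d * a = a * d.

Lemma drazin_projection_idem : a * d * (a * d) = a * d.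
Proof. by rewrite -mulrA (mulrA d) dad. Qed.

Lemma drazin_projection_fix_expr : a * d * a ^+ k = a ^+ k.
Proof. by rewrite -da -mulrA -exprS. Qed.

Lemma drazin_expr_factor : d = a ^+ k * d ^+ k.+1.
Proof.
have add : a * d ^+ 2 = d by rewrite expr2 mulrA -da.
by rewrite (expr_outer add).
Qed.

End DrazinPowers.
End Ring.

Section StarRing.
Variable R : starRingType.
Implicit Types a d f x : R.

Lemma star_cancel_right_multiple (b c u v : R) :
  star b * u = star b * v -> star (b * c) * u = star (b * c) * v.
Proof. by move=> buv; rewrite starM -!mulrA buv. Qed.

Lemma weak_group_inverse_idempotent a x d :
  is_weak_group_inverse a x -> is_drazin_inverse a d ->
  [/\ a * x * (a * x) = a * x,
      principal_right_ideal (a * x) = principal_right_ideal (a * d) &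
      star d * a * (a * x) = star d * a].
Proof.
move=> [k k_gt0 [xak axx wg]] hd.
(* By uniqueness [d] has the explicit form built from [x], and so satisfies
   the Drazin relations with the same exponent [k] as [x]. *)
have dE := drazin_inverse_uniq hd (drazin_of_left_inverse axx xak k_gt0).
have dak : d * a ^+ k.+1 = a ^+ k.
  by rewrite dE -mulrA -exprD addnC expr_left_cancel.
case: hd => _ _ [_ dad da].
have dF := drazin_expr_factor k dad da.
have ff : a * x * (a * x) = a * x.
  by rewrite -mulrA (mulrA x) (outer_inverse axx xak).
split=> //.
- apply/principal_right_ideal_idemP => //.
    exact: drazin_projection_idem.
  split.
    rewrite {1}dF -!mulrA (mulrA a (a ^+ k)) -exprS.
    by rewrite (mulrA x) xak -dF.
  rewrite -{1}(expr_outer axx k) (mulrA a (a ^+ k)) -exprS exprSr.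
  rewrite !mulrA (drazin_projection_fix_expr dak da) -exprSr exprS.
  by rewrite -mulrA expr_outer.
- rewrite -!mulrA dF; apply: star_cancel_right_multiple.
  by rewrite -wg expr2 !mulrA.
Qed.

Lemma drazin_idempotent_weak_group_inverse a d f :
  is_drazin_inverse a d -> f * f = f ->
  principal_right_ideal f = principal_right_ideal (a * d) ->
  star d * a * f = star d * a ->
  is_weak_group_inverse a (d * f).
Proof.
move=> [k k_gt0 [dak dad da]] ff.
move/(principal_right_ideal_idemP (drazin_projection_idem dad) ff).
move=> [fad adf] sdf.
have fak : f * a ^+ k = a ^+ k.
  by rewrite -(drazin_projection_fix_expr dak da) mulrA fad.
have fd : f * d = d by rewrite -{1}dad da !mulrA -(mulrA f) fad -da.
exists k => //; split.
- by rewrite exprSr -(mulrA d) (mulrA f) fak -exprSr.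
- by rewrite expr2 -(mulrA d) (mulrA f) fd !mulrA -da dad.
- rewrite expr2 -!mulrA (mulrA a d) adf -dak.
  by apply: star_cancel_right_multiple; rewrite mulrA.
Qed.

End StarRing.

Theorem proposition3p1 (R : starRingType) (a : R) :
  (weak_group_invertible a <->
     drazin_invertible a /\
     exists f : R,
       [/\ f * f = f,
           principal_right_ideal f =
             principal_right_ideal (a * drazin_inverse a) &
           star (drazin_inverse a) * a * f = star (drazin_inverse a) * a])
  /\
  (forall f : R,
     drazin_invertible a ->
     f * f = f ->
     principal_right_ideal f = principal_right_ideal (a * drazin_inverse a) ->
     star (drazin_inverse a) * a * f = star (drazin_inverse a) * a ->
     is_weak_group_inverse a (drazin_inverse a * f)).
Proof.
have wgi f : drazin_invertible a -> f * f = f ->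
    principal_right_ideal f = principal_right_ideal (a * drazin_inverse a) ->
    star (drazin_inverse a) * a * f = star (drazin_inverse a) * a ->
    is_weak_group_inverse a (drazin_inverse a * f).
  by move/drazin_inverseP; exact: drazin_idempotent_weak_group_inverse.
split=> //; split=> [[x hx] | [ha [f [ff fR sf]]]].
- have ha : drazin_invertible a.
    case: (hx) => k k_gt0 [xak axx _].
    by eexists; exact: (drazin_of_left_inverse axx xak k_gt0).
  split=> //; exists (a * x).
  exact: weak_group_inverse_idempotent hx (drazin_inverseP ha).
- by exists (drazin_inverse a * f); exact: wgi.
Qed.
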